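(* For $n\ge 2$ let $u=u_n$ be the state on $\mathbb{C}S_n$ determined by $u(\delta^\sigma)=\langle \xi, P(\sigma)\xi\rangle$ for $\sigma\in S_n$, where $P$ is the permutation representation of $S_n$ on $\mathbb{C}^n$, $P(\sigma)e_i=e_{\sigma(i)}$, and $\xi\in\mathbb{C}^n$ is the unit vector with components $$\alpha_i=\sqrt{n^{n-i}\,\frac{n-1}{n^n-1}},\qquad i=1,\dots,n.$$ Let $\pi$ be the Haar state of $\widehat{S_n}$. Then for every $B>1$ there exists $N$ such that for all $n\ge N$ and all real $\alpha>0$ for which $k=\alpha\,n^{n-2}$ is a positive integer, $$\|u^{\star k}-\pi\|\geq\frac12 e^{-B\alpha}.$$
   Context: $\mathbb{C}S_n$ is the group algebra of the symmetric group $S_n$ with basis $\{\delta^\sigma:\sigma\in S_n\}$, product $\delta^\sigma\delta^{\sigma'}=\delta^{\sigma\sigma'}$, involution $(\delta^\sigma)^*=\delta^{\sigma^{-1}}$ and its $\mathrm{C}^*$-algebra structure; with comultiplication $\Delta(\delta^\sigma)=\delta^\sigma\otimes\delta^\sigma$ it is the algebra of functions $F(\widehat{S_n})$ on the finite quantum group $\widehat{S_n}$. Its Haar state is $\pi(\delta^\sigma)=1$ if $\sigma=e$ and $0$ otherwise. A state is a positive linear functional of norm one. The convolution powers of a state $u$ are $u^{\star 1}=u$, $u^{\star(k+1)}=(u\otimes u^{\star k})\Delta$. The total variation distance between states $\nu,\mu$ on $\mathbb{C}S_n$ is $\|\nu-\mu\|=\sup_p|\nu(p)-\mu(p)|$,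 the supremum over projections $p\in\mathbb{C}S_n$ ($p=p^*=p^2$). *)

(* Defs.v *)
From HB Require Import structures.
From mathcomp Require Import all_boot all_order all_algebra all_fingroup.
From mathcomp Require Import complex ring.
From mathcomp Require Import all_classical all_reals all_analysis.

Set Implicit Arguments.
Unset Strict Implicit.
Unset Printing Implicit Defensive.

Import Order.TTheory GRing.Theory Num.Theory.
Import numFieldNormedType.Exports.
Import ComplexField.Normc.

Local Open Scope classical_set_scope.
Local Open Scope complex_scope.
Local Open Scope ring_scope.

Definition CSn (R : realType) (n : nat) : Type := {ffun 'S_n -> R[i]}.

HB.instance Definition _ (R : realType) (n : nat) :=
  GRing.Lmodule.copy (CSn R n) {ffun 'S_n -> R[i]^o}.

Section GroupAlgebra.
Variables (R : realType) (n : nat).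
Local Notation C := R[i].
Local Notation A := (CSn R n).
Implicit Types (a b c : A) (s t : 'S_n).

Definition delta s : A := [ffun t => (t == s)%:R].

(* MathComp composes permutations from left to right: (s * t) x = t (s x).
   The product of S_n in [delta s * delta t = delta (s \o t)] is thus
   [(t * s)%g]; see [deltaM] below. *)
Definition cmul a b : A := [ffun t => \sum_s a s * b (t * s^-1)%g].
Definition cone : A := delta 1%g.

Fact cmulA : associative cmul.
Proof.
move=> a b c; apply/ffunP => t; rewrite !ffunE.
under eq_bigr => s _ do rewrite ffunE big_distrr /=.
under [RHS]eq_bigr => s _ do rewrite ffunE big_distrl /=.
rewrite [RHS]exchange_big /=; apply: eq_bigr => s _.
rewrite [RHS](reindex_inj (mulIg s)) /=; apply: eq_bigr => r _.
by rewrite mulgK invMg mulgA mulrA.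
Qed.

Fact cmul1 : left_id cone cmul.
Proof.
move=> a; apply/ffunP => t; rewrite ffunE (bigD1 1%g) //= ffunE eqxx mul1r.
rewrite invg1 mulg1 big1 ?addr0 // => s /negPf s1.
by rewrite ffunE s1 mul0r.
Qed.

Fact cmulr1 : right_id cone cmul.
Proof.
move=> a; apply/ffunP => t; rewrite ffunE (bigD1 t) //= ffunE mulgV eqxx mulr1.
rewrite big1 ?addr0 // => s st; rewrite ffunE.
by rewrite -eq_mulgV1 eq_sym (negPf st) mulr0.
Qed.

Fact cmulDl : left_distributive cmul +%R.
Proof.
move=> a b c; apply/ffunP => t; rewrite !ffunE -big_split /=.
by apply: eq_bigr => s _; rewrite ffunE mulrDl.
Qed.

Fact cmulDr : right_distributive cmul +%R.
Proof.
move=> a b c; apply/ffunP => t; rewrite !ffunE -big_split /=.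
by apply: eq_bigr => s _; rewrite ffunE mulrDr.
Qed.

Fact cone_neq0 : cone != 0.
Proof.
apply/eqP => /ffunP /(_ 1%g); rewrite !ffunE eqxx => /eqP.
by rewrite oner_eq0.
Qed.

HB.instance Definition _ := GRing.Zmodule_isNzRing.Build A
  cmulA cmul1 cmulr1 cmulDl cmulDr cone_neq0.

Fact cscalerAl (k : C) a b : k *: (a * b) = (k *: a) * b.
Proof.
apply/ffunP => t; rewrite !ffunE scaler_sumr.
by apply: eq_bigr => s _; rewrite ffunE -scalerAl.
Qed.

HB.instance Definition _ := GRing.Lmodule_isLalgebra.Build C A cscalerAl.

Fact cscalerAr (k : C) a b : k *: (a * b) = a * (k *: b).
Proof.
apply/ffunP => t; rewrite !ffunE scaler_sumr.
by apply: eq_bigr => s _; rewrite ffunE; exact: mulrCA.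
Qed.

HB.instance Definition _ := GRing.Lalgebra_isAlgebra.Build C A cscalerAr.

Lemma deltaM s t : delta s * delta t = delta (t * s)%g.
Proof.
apply/ffunP => r; rewrite !ffunE (bigD1 s) //= !ffunE eqxx mul1r big1 ?addr0.
  by congr (_%:R); congr (nat_of_bool _); apply/eqP/eqP => [<-|->];
    rewrite ?mulgKV ?mulgK.
by move=> u /negPf us; rewrite ffunE us mul0r.
Qed.

Lemma delta_sum a : a = \sum_s a s *: delta s.
Proof.
apply/ffunP => t; rewrite sum_ffunE (bigD1 t) //= !ffunE eqxx.
rewrite big1 => [|s /negPf st]; first by rewrite addr0; exact/esym/mulr1.
by rewrite !ffunE eq_sym st; exact: mulr0.
Qed.

Definition star a : A := [ffun s => (a s^-1%g)^*].

Lemma star_delta s : star (delta s) = delta s^-1%g.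
Proof.
by apply/ffunP => t; rewrite !ffunE (canF_eq invgK); case: eqP => _;
  rewrite ?conjC1 ?conjC0 ?rmorph1 ?rmorph0.
Qed.

Definition l2norm a : R := Num.sqrt (\sum_s normc (a s) ^+ 2).

(* The C^*-norm: the operator norm of the left regular representation. *)
Definition cstar_norm a : R :=
  sup [set l2norm (a * x) | x in [set x : A | l2norm x <= 1]].

Definition functional_norm (phi : A -> C) : R :=
  sup [set normc (phi a) | a in [set a : A | cstar_norm a <= 1]].

Definition is_state (phi : A -> C) : Prop :=
  (forall a, 0 <= phi (star a * a)) /\ functional_norm phi = 1.

Record state := State {
  state_fun :> {scalar A};
  stateP : is_state state_fun }.

(* [linext f] is the linear functional with values [f] on the basis. *)
Definition linext (f : 'S_n -> C) (a : A) : C := \sum_s a s * f s.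

Fact linext_is_scalar f : scalar (linext f).
Proof.
move=> k a b; rewrite /linext big_distrr -big_split /=.
by apply: eq_bigr => s _; rewrite !ffunE mulrDl mulrA.
Qed.

HB.instance Definition _ f :=
  GRing.isLinear.Build C A C *%R (linext f) (linext_is_scalar f).

Lemma linext_delta f s : linext f (delta s) = f s.
Proof.
rewrite /linext (bigD1 s) //= ffunE eqxx mul1r big1 ?addr0 // => t /negPf ts.
by rewrite ffunE ts mul0r.
Qed.

Definition haar : {scalar A} := linext (fun s => (s == 1%g)%:R).

(* A (x) A is the group algebra of S_n x S_n, with basis the
   delta s (x) delta t; [tensorf phi psi] is phi (x) psi. *)
Definition comult a : {ffun 'S_n * 'S_n -> C} :=
  [ffun st => if st.1 == st.2 then a st.1 else 0].

Definition tensorf (phi psi : A -> C) (x : {ffun 'S_n * 'S_n -> C}) : C :=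
  \sum_(st : 'S_n * 'S_n) x st * (phi (delta st.1) * psi (delta st.2)).

Definition conv (phi psi : A -> C) : A -> C :=
  fun a => tensorf phi psi (comult a).

(* phi^{*k} for k >= 1 (the value at k = 0 is irrelevant). *)
Definition convpow (phi : A -> C) (k : nat) : A -> C :=
  iter k.-1 (conv phi) phi.

Lemma comult_delta s : comult (delta s) = [ffun st => (st == (s, s))%:R].
Proof.
apply/ffunP => -[t r]; rewrite !ffunE /= xpair_eqE.
have [->|tr] := eqVneq t r; first by rewrite andbb.
by case: eqP => // ts; rewrite -ts eq_sym (negPf tr).
Qed.

Lemma conv_delta (phi psi : A -> C) s :
  conv phi psi (delta s) = phi (delta s) * psi (delta s).
Proof.
rewrite /conv /tensorf comult_delta (bigD1 (s, s)) //= ffunE eqxx mul1r.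
by rewrite big1 ?addr0 // => t /negPf ts; rewrite ffunE ts mul0r.
Qed.

Definition is_projection a : Prop := star a = a /\ a * a = a.

Definition tv_dist (phi psi : A -> C) : R :=
  sup [set normc (phi p - psi p) | p in [set p : A | is_projection p]].

Lemma normcE2 (z : C) : (normc z ^+ 2)%:C = z^* * z.
Proof. by rewrite mulrC -sqr_normc rmorphXn /= normc_def; case: z. Qed.

Lemma conj_real (x : R) : Num.conj x%:C = x%:C :> C.
Proof. exact: conjc_real. Qed.

Lemma conj_realM (x : R) (z w : C) :
  Num.conj (x%:C * z) * (x%:C * w) = (x ^+ 2)%:C * (Num.conj z * w).
Proof. by rewrite rmorphM [X in X * _ * _]conj_real mulrACA -rmorphM. Qed.

Lemma normc_ge0 (z : C) : 0 <= normc z.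
Proof. by case: z => x y /=; exact: sqrtr_ge0. Qed.

Definition inn a b : C := \sum_s (a s)^* * b s.

Lemma innE a : inn a a = (\sum_s normc (a s) ^+ 2)%:C.
Proof. by rewrite rmorph_sum; apply: eq_bigr => s _; exact/esym/normcE2. Qed.

Lemma inn_star a b c : inn a (star b * c) = inn (b * a) c.
Proof.
rewrite /inn; under eq_bigr => t _ do rewrite ffunE big_distrr /=.
under [RHS]eq_bigr => t _ do rewrite ffunE rmorph_sum big_distrl /=.
rewrite exchange_big [RHS]exchange_big /= (reindex_inj invg_inj) /=.
apply: eq_bigr => s _; rewrite [RHS](reindex_inj (mulIg s)) /=.
apply: eq_bigr => t _; rewrite ffunE !invgK mulgK rmorphM /=.
by rewrite mulrA [X in X * _]mulrC.
Qed.

Lemma l2norm_ge0 a : 0 <= l2norm a.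
Proof. exact: sqrtr_ge0. Qed.

Lemma l2norm_sqr a : l2norm a ^+ 2 = \sum_s normc (a s) ^+ 2.
Proof. by rewrite sqr_sqrtr // sumr_ge0 // => s _; exact: sqr_ge0. Qed.

Lemma normc_le_l2norm a s : normc (a s) <= l2norm a.
Proof.
rewrite -(ler_pXn2r (ltn0Sn 1)) ?nnegrE ?l2norm_ge0 ?normc_ge0 //.
rewrite l2norm_sqr (bigD1 s) //= lerDl sumr_ge0 // => t _; exact: sqr_ge0.
Qed.

Lemma normc_sum (I : Type) (r : seq I) (F : I -> C) :
  normc (\sum_(i <- r) F i) <= \sum_(i <- r) normc (F i).
Proof.
elim: r => [|i r IH]; first by rewrite !big_nil normc0.
rewrite !big_cons; apply: le_trans (le_normcD _ _) _; exact: lerD.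
Qed.

Lemma cstar_has_ubound a :
  has_ubound [set l2norm (a * x) | x in [set x : A | l2norm x <= 1]].
Proof.
pose M := \sum_s normc (a s).
have M0 : 0 <= M by apply: sumr_ge0 => s _; exact: normc_ge0.
exists (Num.sqrt (\sum_(s : 'S_n) M ^+ 2)) => _ [x /= x1 <-].
apply: ler_wsqrtr; apply: ler_sum => t _.
rewrite ler_pXn2r ?nnegrE ?normc_ge0 //.
rewrite ffunE; apply: le_trans (normc_sum _ _) _; apply: ler_sum => s _.
rewrite normcM ler_piMr ?normc_ge0 //.
exact: le_trans (normc_le_l2norm _ _) x1.
Qed.

Lemma cstar_norm1 : cstar_norm 1 <= 1.
Proof.
apply: ge_sup => [|_ [x /= x1 <-]]; last by rewrite mul1r.
exists (l2norm (1 * 0)), 0 => //=; rewrite /l2norm big1 ?sqrtr0 // => s _.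
by rewrite ffunE normc0 expr0n.
Qed.

Lemma inn_subZ a b (c : C) : inn (b - c *: a) (b - c *: a) =
  inn b b - c * inn b a - c^* * inn a b + c^* * c * inn a a.
Proof.
rewrite /inn !big_distrr /= -!sumrB -big_split /=; apply: eq_bigr => s _.
have -> : (b - c *: a) s = b s - c * a s by rewrite !ffunE.
by rewrite rmorphB rmorphM /=; ring.
Qed.

(* Cauchy-Schwarz for a unit vector *)
Lemma inn_le a b : l2norm a = 1 -> normc (inn a b) <= l2norm b.
Proof.
move=> a1; set c := inn a b.
have aa : inn a a = 1 by rewrite innE -l2norm_sqr a1 expr1n.
have cJ : inn b a = c^*.
  rewrite /c /inn rmorph_sum; apply: eq_bigr => s _.
  by rewrite rmorphM /= conjCK mulrC.
have : 0 <= (\sum_s normc ((b - c *: a) s) ^+ 2)%:C.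
  by rewrite ler0c; apply: sumr_ge0 => s _; exact: sqr_ge0.
rewrite -innE.
rewrite inn_subZ aa cJ mulr1 -/c [c * _]mulrC subrK innE -normcE2 -rmorphB ler0c.
rewrite subr_ge0 -l2norm_sqr ler_pXn2r ?nnegrE ?l2norm_ge0 ?normc_ge0 //.
Qed.

Lemma vector_stateP (phi : {scalar A}) (eta : A) :
  l2norm eta = 1 -> (forall a, phi a = inn eta (a * eta)) -> is_state phi.
Proof.
move=> eta1 phiE; split=> [a|].
  rewrite phiE -mulrA inn_star innE ler0c.
  by apply: sumr_ge0 => s _; exact: sqr_ge0.
have phi_le a : normc (phi a) <= cstar_norm a.
  rewrite phiE; apply: le_trans (inn_le _ eta1) _.
  by apply: ub_le_sup; [exact: cstar_has_ubound | exists eta => //=; rewrite eta1].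
have phi1 : phi 1 = 1 by rewrite phiE mul1r innE -l2norm_sqr eta1 expr1n.
have ub : ubound [set normc (phi a) | a in [set a : A | cstar_norm a <= 1]] 1.
  by move=> _ [a /= a1 <-]; exact: le_trans (phi_le a) a1.
have mem1 : [set normc (phi a) | a in [set a : A | cstar_norm a <= 1]] 1.
  by exists 1; rewrite ?phi1 ?normc1 //; exact: cstar_norm1.
apply/eqP; rewrite eq_le; apply/andP; split.
  by apply: ge_sup => //; exists 1.
by apply: ub_le_sup => //; exists 1.
Qed.

Lemma inn_mulE (eta : A) a :
  inn eta (a * eta) = \sum_s a s * (\sum_t (eta t)^* * eta (t * s^-1)%g).
Proof.
rewrite /inn; under eq_bigr => t _ do rewrite ffunE big_distrr /=.
rewrite exchange_big /=; apply: eq_bigr => s _; rewrite big_distrr /=.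
by apply: eq_bigr => t _; rewrite mulrCA.
Qed.

Lemma l2norm_delta s : l2norm (delta s) = 1.
Proof.
rewrite /l2norm (bigD1 s) //= ffunE eqxx normc1 expr1n big1 ?addr0 ?sqrtr1 //.
by move=> t /negPf ts; rewrite ffunE ts normc0 expr0n.
Qed.

Fact haar_is_state : is_state haar.
Proof.
apply: (vector_stateP (l2norm_delta 1%g)) => a.
rewrite inn_mulE /=; apply: eq_bigr => s _; congr (_ * _).
rewrite (bigD1 1%g) //= !ffunE eqxx rmorph1 mul1r mul1g big1 ?addr0.
  by rewrite eq_invg1.
by move=> t /negPf t1; rewrite ffunE t1 rmorph0 mul0r.
Qed.

Definition haar_state : state := State haar_is_state.

(* The supremum defining [tv_dist] is over a bounded nonempty set. *)
Lemma tv_dist_has_sup (f g : 'S_n -> C) :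
  has_sup [set normc (linext f p - linext g p)
          | p in [set p : A | is_projection p]].
Proof.
split; first by exists (normc (linext f 0 - linext g 0)), 0 => //=; split;
  [apply/ffunP => s; rewrite !ffunE rmorph0 | rewrite mulr0].
exists (\sum_s (normc (f s) + normc (g s))) => _ [p [ps pp] <-].
rewrite -sumrB; apply: le_trans (normc_sum _ _) _; apply: ler_sum => s _.
rewrite -mulrBr normcM.
suff p1 : normc (p s) <= 1.
  apply: le_trans (_ : normc (f s - g s) <= _).
    by rewrite ler_piMl ?normc_ge0.
  by rewrite -[X in _ <= _ + X]normcN le_normcD.
have E : p 1%g = (l2norm p ^+ 2)%:C.
  have pJ t : p t^-1%g = (p t)^* by rewrite -{1}ps ffunE invgK.
  rewrite -{1}pp ffunE l2norm_sqr -innE; apply: eq_bigr => t _.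
  by rewrite mul1g pJ mulrC.
have : normc (p 1%g) <= l2norm p := normc_le_l2norm p 1%g.
rewrite E /= expr0n addr0 sqrtr_sqr ger0_norm ?sqr_ge0 // expr2.
move=> le1; apply: le_trans (normc_le_l2norm p s) _.
have := l2norm_ge0 p; rewrite le_eqVlt => /orP[/eqP <- //|p0].
by rewrite -(ler_pM2l p0) mulr1.
Qed.

End GroupAlgebra.

Section PermutationState.
Variables (R : realType) (n : nat).
Local Notation C := R[i].

Definition inner (x y : 'cV[C]_n) : C := \sum_i (x i 0)^* * y i 0.

(* [perm_mx s] sends the row vector e_i to e_(s i). *)
Definition permrep (s : 'S_n) : 'M[C]_n := (perm_mx s)^T.

Lemma permrepE s i : permrep s *m delta_mx i 0 = delta_mx (s i) 0 :> 'cV_n.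
Proof.
rewrite /permrep -[delta_mx i 0]trmxK -trmx_mul trmx_delta -rowE.
by apply/matrixP => j k; rewrite !mxE !ord1 eqxx andbT eq_sym.
Qed.

(* The ordinal i stands for the index i + 1 in {1, ..., n}. *)
Definition xi : 'cV[C]_n :=
  \col_(i < n) (Num.sqrt
    (n%:R ^+ (n - i.+1) * ((n%:R - 1) / (n%:R ^+ n - 1))))%:C.

Definition perm_fun : {scalar CSn R n} :=
  linext (fun s => inner xi (permrep s *m xi)).

Lemma permrep_mulE s (x : 'cV[C]_n) i : (permrep s *m x) i 0 = x ((s^-1)%g i) 0.
Proof.
rewrite mxE (bigD1 ((s^-1)%g i)) //= !mxE permKV eqxx mul1r big1 ?addr0 //.
move=> j ji; rewrite !mxE; case: eqP => [sji|_]; last by rewrite mul0r.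
by rewrite -sji permK eqxx in ji.
Qed.

Hypothesis n2 : (1 < n)%N.

Let n0 : (0 < n)%N := ltnW n2.

Lemma inner_xi : inner xi xi = 1.
Proof.
have n1R : 1 < n%:R :> R by rewrite ltr1n.
have nnR : 1 < n%:R ^+ n :> R by rewrite exprn_egt1 // -lt0n.
pose q : R := (n%:R - 1) / (n%:R ^+ n - 1).
have q0 : 0 <= q by rewrite divr_ge0 ?subr_ge0 ?ltW.
suff E : \sum_(i < n) (n%:R ^+ (n - i.+1) * q) = 1 :> R.
  rewrite /inner -[RHS]/((1 : R)%:C) -E rmorph_sum; apply: eq_bigr => i _.
  rewrite mxE conj_real -rmorphM -expr2 sqr_sqrtr //.
  by rewrite mulr_ge0 ?exprn_ge0 ?ler0n.
rewrite -big_distrl /= (reindex_inj rev_ord_inj) /=.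
have -> : \sum_(i < n) (n%:R : R) ^+ (n - (n - i.+1).+1) = \sum_(i < n) n%:R ^+ i.
  by apply: eq_bigr => i _; rewrite subnSK // subKn // ltnW.
rewrite mulrA [X in X / _]mulrC -subrX1 divff //.
by rewrite subr_eq0 gt_eqF.
Qed.

Lemma sum_perm (f : 'I_n -> C) (i0 : 'I_n) :
  n%:R * (\sum_(t : 'S_n) f (t i0)) = n`!%:R * \sum_i f i.
Proof.
transitivity (\sum_(j < n) \sum_(t : 'S_n) f (t j)).
  rewrite [RHS](eq_bigr (fun=> \sum_(t : 'S_n) f (t i0))) => [|j _].
    by rewrite sumr_const card_ord mulr_natl.
  rewrite (reindex_inj (mulgI (tperm i0 j))) /=; apply: eq_bigr => t _.
  by rewrite permM tpermR.
rewrite exchange_big [LHS](eq_bigr (fun=> \sum_i f i)) => [|t _].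
  by rewrite sumr_const card_Sn mulr_natl.
by rewrite [RHS](reindex_inj (@perm_inj _ t)).
Qed.

(* [eta] is the image of [xi] under the isometric intertwiner
   C^n -> l^2(S_n), e_i |-> sqrt(n / n!) \sum_(t 0 = i) delta t. *)
Let eta : CSn R n :=
  [ffun t : 'S_n => (Num.sqrt (n%:R / n`!%:R))%:C * xi (t (Ordinal n0)) 0].

Let perm_funE a : perm_fun a = inn eta (a * eta).
Proof.
rewrite inn_mulE; apply: eq_bigr => s _; congr (_ * _).
set c : R := n%:R / n`!%:R.
have c0 : 0 <= c by rewrite divr_ge0 ?ler0n.
pose f i := (xi i 0)^* * xi ((s^-1)%g i) 0.
transitivity (c%:C * \sum_(t : 'S_n) f (t (Ordinal n0))); last first.
  rewrite big_distrr /=; apply: eq_bigr => t _.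
  by rewrite !ffunE permM; apply/esym; rewrite conj_realM sqr_sqrtr.
have -> : c%:C = n`!%:R^-1 * n%:R.
  by rewrite /c rmorphM fmorphV !rmorph_nat mulrC.
rewrite -mulrA (sum_perm f) mulKf ?pnatr_eq0 -?lt0n ?fact_gt0 //.
by apply: eq_bigr => i _; rewrite permrep_mulE.
Qed.

Fact perm_is_state : is_state perm_fun.
Proof.
apply: (vector_stateP _ perm_funE).
have : inn eta eta = 1.
  rewrite -{2}[eta]mul1r -perm_funE [LHS]linext_delta.
  have -> : permrep 1%g *m xi = xi.
    by rewrite /permrep perm_mx1 trmx1 mul1mx.
  exact: inner_xi.
rewrite innE -l2norm_sqr => /(congr1 (@complex.Re R)) /= /eqP.
by rewrite sqrp_eq1 ?l2norm_ge0 // => /eqP.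
Qed.

Definition perm_state : state R n := State perm_is_state.

Lemma perm_state_delta s :
  perm_state (delta R s) = inner xi (permrep s *m xi).
Proof. exact: linext_delta. Qed.

End PermutationState.

(* Main.v *)
(** For the transposition [s] of the last two points, [(1 + delta s) / 2] is a
    projection on which [u^{*k} - pi] takes the value [u(s)^k / 2], and
    [u(s) = 1 - (a - b)^2] with [a], [b] the last two coordinates of [xi].
    Here [(a - b)^2 <= a^2 - b^2 = (n - 1)^2 / (n^n - 1) <= 1 / (n^(n-2) + 1)],
    whence [u(s) >= exp(- 1 / n^(n-2))]. *)
Require Import Defs.
From mathcomp Require Import all_boot all_order all_algebra all_fingroup.
From mathcomp Require Import complex ring lra.
From mathcomp Require Import all_classical all_reals all_analysis.
Import Order.TTheory GRing.Theory Num.Theory.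
Import ComplexField.Normc.

Set Implicit Arguments.
Unset Strict Implicit.
Unset Printing Implicit Defensive.

Local Open Scope complex_scope.
Local Open Scope ring_scope.

(** [comult a] is supported on the diagonal, which collapses the double sum defining the
    convolution. *)
Lemma convE (R : realType) (n : nat) (phi psi : CSn R n -> R[i]) a :
  Defs.conv phi psi a = linext (fun s => phi (delta R s) * psi (delta R s)) a.
Proof.
transitivity (\sum_(s : 'S_n) \sum_(t : 'S_n)
  comult a (s, t) * (phi (delta R s) * psi (delta R t))).
  by rewrite pair_bigA; apply: eq_bigr => -[].
apply: eq_bigr => s _; rewrite (bigD1 s) //= ffunE eqxx big1 ?addr0 // => t ts.
by rewrite ffunE /= eq_sym (negPf ts) mul0r.
Qed.

(** The basis is group-like, so convolution multiplies coefficients pointwise. Positivity of [k]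
    matters: [convpow] at [0] returns the functional itself. *)
Lemma convpowE (R : realType) (n : nat) (f : 'S_n -> R[i]) (k : nat) :
  (0 < k)%N -> convpow (linext f) k = linext (fun s => f s ^+ k).
Proof.
case: k => // k _; elim: k => [|k IH]; apply/funext => a //=.
rewrite /convpow /= -/(convpow (linext f) k.+1) IH convE.
by apply: eq_bigr => s _; rewrite !linext_delta -exprS.
Qed.

Lemma involution_projection (R : realType) (n : nat) (s : 'S_n) :
  (s * s = 1)%g ->
  is_projection ((2^-1 : R)%:C *: (delta R 1%g + delta R s)).
Proof.
move=> ss1; have sV : (s^-1)%g = s by apply/eqP; rewrite eq_invg_mul ss1.
(* As [s] is an involution, the square of [1 + delta s] is twice itself, so idempotency comes down
   to this identity. *)
set h := (2^-1 : R)%:C; have h2 : h * h * 2 = h.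
  rewrite /h; have -> : 2 = (2 : R)%:C by rewrite rmorph_nat.
  by rewrite -!rmorphM /=; congr _%:C; field.
split; first apply/ffunP => t.
  have ->: forall b : CSn R n, star (h *: b) t = h * star b t.
    by move=> b; rewrite !ffunE rmorphM /= conj_real.
  have ->: star (delta R 1%g + delta R s) = delta R 1%g + delta R s.
    rewrite -{2}sV -{2}invg1 -!star_delta.
    by apply/ffunP => r; rewrite !ffunE rmorphD.
  by rewrite [RHS]ffunE.
rewrite -scalerAl -scalerAr scalerA mulrDl !mulrDr !deltaM ss1 !mulg1 mul1g.
rewrite [delta R s + _]addrC -mulr2n -scaler_nat scalerA.
by rewrite h2.
Qed.

Lemma normc_realC (R : rcfType) (x : R) : normc x%:C = `|x|.
Proof. by rewrite /= expr0n addr0 sqrtr_sqr. Qed.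

Lemma tv_dist_ge_involution (R : realType) (n : nat) (f g : 'S_n -> R[i])
    (s : 'S_n) : (s * s = 1)%g ->
  2^-1 * normc ((f 1%g - g 1%g) + (f s - g s))
    <= tv_dist (linext f) (linext g).
Proof.
move=> ss1; apply: ub_le_sup; first by case: (tv_dist_has_sup f g).
exists ((2^-1 : R)%:C *: (delta R 1%g + delta R s)).
  exact: involution_projection.
have linextE h : linext h ((2^-1 : R)%:C *: (delta R 1%g + delta R s))
    = (2^-1 : R)%:C * (h 1%g + h s) by rewrite linearZ linearD /= !linext_delta.
rewrite !linextE -mulrBr normcM normc_realC ger0_norm ?invr_ge0 ?ler0n //.
by congr (_ * normc _); ring.
Qed.

(** Only the terms at [i] and [j] change, and [2 f i f j = (f i)^2 + (f j)^2 - (f i - f j)^2]. *)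
Lemma sum_mul_tperm (R : comNzRingType) (I : finType) (f : I -> R) (i j : I) :
  i != j ->
  \sum_k f k * f (tperm i j k) = \sum_k f k ^+ 2 - (f i - f j) ^+ 2.
Proof.
move=> ij; have ji : j != i by rewrite eq_sym.
rewrite (bigD1 i) //= (bigD1 j) //= [in RHS](bigD1 i) //= [in RHS](bigD1 j) //=.
rewrite tpermL tpermR; under eq_bigr => k /andP[ki kj] do
  rewrite tpermD 1?eq_sym // -expr2.
ring.
Qed.

Lemma inner_xi_tperm (R : realType) (n : nat) (i j : 'I_n) (a b : R) :
  (1 < n)%N -> i != j -> xi R n i 0 = a%:C -> xi R n j 0 = b%:C ->
  inner (xi R n) (permrep R (tperm i j) *m xi R n) = (1 - (a - b) ^+ 2)%:C.
Proof.
move=> n2 ij xia xjb; rewrite rmorphB rmorphXn rmorphB /= -xia -xjb.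
have xiJ l : Num.conj (xi R n l 0) = xi R n l 0 by rewrite mxE conj_real.
rewrite -[_%:C](inner_xi R n2) /inner.
under eq_bigr => l _ do rewrite permrep_mulE tpermV xiJ.
under [in RHS]eq_bigr => l _ do rewrite xiJ -expr2.
exact: sum_mul_tperm.
Qed.

(** Inverting [1 + 1/m <= exp (1/m)] gives [exp (-1/m) <= m/(m+1) = 1 - 1/(m+1)]. *)
Lemma expR_le_of_gap (R : realType) (m x : R) :
  0 < m -> x <= (m + 1)^-1 -> expR (- m^-1) <= 1 - x.
Proof.
move=> m0 xm; rewrite expRN.
apply: le_trans (_ : (1 + m^-1)^-1 <= _).
  by rewrite lef_pV2 ?posrE ?expR_gt0 ?expR_ge1Dx // addr_gt0 ?invr_gt0.
have -> : (1 + m^-1)^-1 = 1 - (m + 1)^-1 by field; rewrite !gt_eqF ?addr_gt0.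
by rewrite lerD2l lerN2.
Qed.

Lemma gap_bound (R : realFieldType) (n : nat) : (2 < n)%N ->
  (n%:R - 1) * ((n%:R - 1) / (n%:R ^+ n - 1))
    <= (n%:R ^+ (n - 2) + 1 : R)^-1.
Proof.
move=> n3; set x : R := n%:R; set m := x ^+ (n - 2).
have x3 : 3 <= x by rewrite ler_nat.
(* Clearing denominators leaves [(x - 1)^2 (m + 1) <= m x^2 - 1], that is
   [x^2 - 2 x + 2 <= m (2 x - 1)], which follows from [x <= m] and [3 <= x]. *)
have xm : x <= m.
  by rewrite -[X in X <= _]expr1 ler_weXn2l ?subn_gt0 //; lra.
have -> : x ^+ n = m * x ^+ 2 by rewrite -exprD subnK // ltnW.
have d0 : 0 < m * x ^+ 2 - 1 by nra.
rewrite mulrA ler_pdivrMr // [leRHS]mulrC ler_pdivlMr; last lra.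
nra.
Qed.

Lemma sqrB_le_subr_sqr (R : realDomainType) (a b : R) :
  0 <= b <= a -> (a - b) ^+ 2 <= a ^+ 2 - b ^+ 2.
Proof. by move=> /andP[b0 ba]; nra. Qed.

Lemma perm_state_gap (R : realType) (n : nat) (i j : 'I_n) :
  (2 < n)%N -> i = (n - 2)%N :> nat -> j = (n - 1)%N :> nat ->
  exists2 v : R, expR (- (n%:R ^+ (n - 2))^-1) <= v &
    inner (xi R n) (permrep R (tperm i j) *m xi R n) = v%:C.
Proof.
move=> n3 i2 j1; have n2 := ltnW n3; have n0 := ltnW n2.
set q : R := (n%:R - 1) / (n%:R ^+ n - 1).
have n1R : 1 <= n%:R :> R by rewrite ler1n.
have q0 : 0 <= q by rewrite divr_ge0 ?subr_ge0 ?exprn_ege1.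
(* Ordinals start at 0, so [i] and [j] are the last two indices, where the exponents of [n] in [xi]
   are 1 and 0. *)
have xia : xi R n i 0 = (Num.sqrt (n%:R * q))%:C.
  by rewrite mxE i2 -subSn // subSS subKn.
have xjb : xi R n j 0 = (Num.sqrt q)%:C.
  by rewrite mxE j1 subn1 prednK // subnn mul1r.
have ij : i != j.
  by rewrite -val_eqE /= i2 j1 -(subnSK n2) neq_ltn ltnSn.
rewrite (inner_xi_tperm n2 ij xia xjb); eexists; last reflexivity.
apply: expR_le_of_gap; first by rewrite exprn_gt0 // ltr0n.
apply: le_trans (gap_bound _ n3); rewrite -/q.
apply: le_trans (sqrB_le_subr_sqr _) _.
  by rewrite sqrtr_ge0 ler_wsqrtr // ler_peMl.
by rewrite !sqr_sqrtr ?(mulr_ge0 _ q0) ?ler0n // mulrBl mul1r.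
Qed.

Theorem mainTheorem3 (R : realType) (B : R) (hB : 1 < B) :
  exists N : nat, forall (n : nat) (n2 : (1 < n)%N), (N <= n)%N ->
  forall (alpha : R) (k : nat), 0 < alpha -> (0 < k)%N ->
    k%:R = alpha * n%:R ^+ (n - 2) ->
    2^-1 * expR (- B * alpha)
      <= tv_dist (convpow (perm_state R n2) k) (haar_state R n).
Proof.
(* The same threshold serves every [B]: from [n = 3] on the bound holds with [exp (- alpha)], and
   [B > 1] enters only in the final comparison. *)
exists 3%N => n n2 n3 alpha k alpha0 k0 kE.
have lt2 : (n - 2 < n)%N by rewrite ltn_subrL (ltnW n2).
have lt1 : (n - 1 < n)%N by rewrite ltn_subrL (ltnW n2).
pose i := Ordinal lt2; pose j := Ordinal lt1; pose s := tperm i j.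
have [v v_ge uE] := perm_state_gap R (i := i) (j := j) n3 erefl erefl.
have v0 : 0 <= v := le_trans (expR_ge0 _) v_ge.
have s1 : s != 1%g.
  apply/eqP => /permP /(_ i); rewrite tpermL perm1 => /(congr1 val) /= /eqP.
  by rewrite -(subnSK n2) gtn_eqF.
rewrite /perm_state /= /perm_fun convpowE // /haar.
apply: le_trans (tv_dist_ge_involution _ _ (tperm2 i j)).
(* At the identity both functionals equal 1 and cancel; at [s] the Haar state vanishes, leaving
   [v ^+ k]. *)
rewrite ler_pM2l ?invr_gt0 //= eqxx (negPf s1) uE.
rewrite /permrep perm_mx1 trmx1 mul1mx (inner_xi R n2) expr1n subrr add0r subr0.
rewrite -rmorphXn normc_realC ger0_norm ?exprn_ge0 //.
(* By [kE] this power equals [exp (- alpha)]. *)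
apply: le_trans (_ : expR (- (n%:R ^+ (n - 2))^-1) ^+ k <= _).
  rewrite -expRM_natl ler_expR kE mulrN mulfK ?expf_neq0 ?pnatr_eq0 -?lt0n 1?ltnW //.
  by rewrite mulNr lerN2 ler_peMl // ltW.
by apply: lerXn2r; rewrite ?nnegrE ?expR_ge0.
Qed.
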